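(* For all integers $n\ge 0$, $|\mathcal{O}(\mathrm{LPF}_n)|=B_n$, where $B_n$ is the $n$-th Bell number.
   Context: Let $[n]=\{1,\ldots,n\}$. A Lehmer parking function of length $n$ is a tuple $\alpha=(a_1,\ldots,a_n)\in[n]^n$ with $a_i\le n-i+1$ for all $i\in[n]$; $\mathrm{LPF}_n$ is the set of these. Cars $1,2,\ldots,n$ arrive in this order on a one-way street with spots $1,\ldots,n$; car $i$ parks in the first empty spot at or after its preference $a_i$. A tuple is a parking function if all cars park; every Lehmer parking function is a parking function. The outcome $\mathcal{O}(\alpha)$ is the permutation $\pi=\pi_1\cdots\pi_n$ of $[n]$ where $\pi_i=j$ means that spot $i$ is occupied by car $j$ at the end. $\mathcal{O}(\mathrm{LPF}_n)=\{\mathcal{O}(\alpha):\alpha\in\mathrm{LPF}_n\}$. The Bell number $B_n$ is the number of set partitions of $[n]$ (sets of nonempty pairwise disjoint subsets of $[n]$ with union $[n]$). For $n=0$, the only Lehmer parking function is the empty tuple, with outcome the empty permutation, and $B_0=1$. *)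

(* Defs.v *)
From mathcomp Require Import all_boot all_fingroup.

Set Implicit Arguments.
Unset Strict Implicit.
Unset Printing Implicit Defensive.

(* Cars, spots and preferences are numbered from 0: the element i of 'I_n
   stands for i.+1 in {1, ..., n}. *)

(* In 1-based numbering the condition reads a_i <= n - i + 1. *)
Definition LPF (n : nat) : {set n.-tuple 'I_n} :=
  [set a : n.-tuple 'I_n | [forall i : 'I_n, tnth a i < n - i]].

(* [s j = Some c] when car [c] occupies spot [j], [None] when [j] is empty. *)
Definition street (n : nat) := {ffun 'I_n -> option 'I_n}.

Definition first_empty n (s : street n) (p : 'I_n) : option 'I_n :=
  [pick j : 'I_n | [&& p <= j, s j == None &
    [forall k : 'I_n, (p <= k < j) ==> (s k != None)]]].

(* A car that finds no empty spot leaves the street unchanged. *)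
Definition park n (a : n.-tuple 'I_n) (s : street n) (i : 'I_n) : street n :=
  if first_empty s (tnth a i) is Some j
  then [ffun k => if k == j then Some i else s k]
  else s.

Definition final_street n (a : n.-tuple 'I_n) : street n :=
  foldl (park a) [ffun=> None] (enum 'I_n).

(* [None] exactly when [a] is not a parking function; the permutation sends
   a spot to the car occupying it. *)
Definition outcome n (a : n.-tuple 'I_n) : option {perm 'I_n} :=
  [pick p : {perm 'I_n} | [forall j, final_street a j == Some (p j)]].

Definition outcomes n (A : {set n.-tuple 'I_n}) : {set {perm 'I_n}} :=
  [set p | [exists a in A, outcome a == Some p]].

Definition Bell (n : nat) : nat :=
  #|[set P : {set {set 'I_n}} | partition P [set: 'I_n]]|.

Lemma first_emptyP n (s : street n) (p : 'I_n) :
  (exists j : 'I_n, p <= j /\ s j = None) ->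
  exists j, first_empty s p = Some j /\ s j = None.
Proof.
case=> j0 [pj0 sj0]; rewrite /first_empty; case: pickP => [j /and3P[_ /eqP sj _]|no].
  by exists j.
have P0 : (p <= j0) && (s j0 == None) by rewrite pj0 sj0 eqxx.
have [j /andP[pj sj] jmin] :=
  @arg_minnP _ j0 (fun j : 'I_n => (p <= j) && (s j == None)) val P0.
move: (no j); rewrite pj sj /= => /negbT/negP[]; apply/forallP=> k.
apply/implyP=> /andP[pk kj]; apply/negP=> sk.
by move: (jmin k); rewrite pk sk /= leqNgt kj => /(_ isT).
Qed.

(* Every Lehmer parking function is a parking function. *)
Lemma LPF_outcome n (a : n.-tuple 'I_n) :
  a \in LPF n -> exists p, outcome a = Some p.
Proof.
rewrite inE => /forallP aL.
have step (s : street n) (i : 'I_n) : #|[set j | s j != None]| <= i ->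
    exists j, s j = None /\ park a s i = [ffun k => if k == j then Some i else s k].
  move=> si; have [|j [fj sj]] := @first_emptyP n s (tnth a i); last first.
    by exists j; rewrite /park fj.
  have [/existsP[j /andP[? /eqP ?]]|/existsPn full] :=
    boolP [exists j : 'I_n, (tnth a i <= j) && (s j == None)]; first by exists j.
  pose h (k : 'I_(n - tnth a i)) := rev_ord (widen_ord (leq_subr _ _) k).
  have hI : injective h by move=> x y /rev_ord_inj[xy]; exact: val_inj.
  have sub : [set h k | k : 'I_(n - tnth a i)] \subset [set j | s j != None].
    apply/subsetP=> _ /imsetP[k _ ->]; rewrite inE.
    have kn := ltn_ord k; have kn' := leq_trans kn (leq_subr _ _).
    have := full (h k); rewrite negb_and => /orP[/negP[]|//] /=.
    by rewrite leq_subRL // addnC -leq_subRL // ltnW.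
  have := leq_trans (subset_leq_card sub) si.
  rewrite card_imset // card_ord.
  by have := aL i; rewrite ltn_subRL addnC -ltn_subRL ltnNge => /negP.
have inv k : k <= n ->
    let s := foldl (park a) [ffun=> None] (take k (enum 'I_n)) in
    #|[set j | s j != None]| <= k /\
    forall c : 'I_n, c < k -> exists j, s j = Some c.
  elim: k => [|k IH] kn /=.
    rewrite take0 /=; split=> //.
    by rewrite leqn0 cards_eq0; apply/eqP/setP=> j; rewrite !inE ffunE eqxx.
  have [cs es] := IH (ltnW kn); set i := Ordinal kn.
  have -> : take k.+1 (enum 'I_n) = rcons (take k (enum 'I_n)) i.
    by rewrite (take_nth i) ?size_enum_ord // -[k]/(val i) nth_ord_enum.
  rewrite foldl_rcons; have [j [sj ->]] := step _ i cs; split.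
    apply: leq_trans (_ : #|j |: [set j | foldl (park a) [ffun=> None]
      (take k (enum 'I_n)) j != None]| <= _).
      apply: subset_leq_card; apply/subsetP=> x; rewrite !inE ffunE.
      by case: (x == j).
    by rewrite cardsU1 -[k.+1]add1n leq_add // leq_b1.
  move=> c; rewrite ltnS leq_eqVlt => /predU1P[ck|/es[x sx]].
    by exists j; rewrite ffunE eqxx; congr Some; apply: val_inj.
  exists x; rewrite ffunE; case: eqP => // xj.
  by move: sx; rewrite xj sj.
have [_] := inv n (leqnn n); rewrite take_oversize ?size_enum_ord // -/(final_street a).
move=> ex.
have ex' c : exists j, final_street a j == Some c.
  by have [j /eqP] := ex c (ltn_ord c); exists j.
pose g c := xchoose (ex' c).
have gP c : final_street a (g c) = Some c by apply/eqP/(xchooseP (ex' c)).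
have gI : injective g.
  by move=> c d gcd; have := gP c; rewrite gcd gP => -[].
rewrite /outcome; case: pickP => [p _|/(_ (perm gI)^-1%g)/negbT/negP[]]; first by exists p.
apply/forallP=> j; rewrite -{1}(permKV (perm gI) j) permE; exact/eqP/gP.
Qed.

(* Main.v *)
Require Import Defs.
From mathcomp Require Import all_boot all_fingroup zify.

(** Let p be a permutation, read as spot to car, and put u s = n - 1 - p s.
    Car p s can end in spot s exactly when its preference lies in a window
    ending at s that is filled by earlier cars. Smaller preferences only make
    this harder, and the Lehmer bound forces the preference to be at most
    n - 1 - p s = u s. So p is an outcome if and only if every spot k with
    u s <= k < s holds an earlier car, i.e. has u s < u k
    ([outcomes_LPF]). Drawing an arc below the line from s to u s for each
    s with u s < s, this says that no two of these lower arcs cross, where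
    an arc ending at the point at which another one starts also counts as
    a crossing ([noncrossing]).

    Noncrossing permutations are in bijection with set partitions. The
    excedances s < u s form increasing paths; let the blocks be these paths
    ([arc_partition]). The consecutive elements of each block are then the
    excedances of u.

    Injectivity ([arc_partition_inj]): the blocks give the excedances; a point
    that lies on no excedance must be fixed, since otherwise two lower arcs
    would touch there; and the lower arcs are then forced from left to right,
    because each position s with u s < s has to take the largest value
    still available below s.

    Surjectivity ([arc_partition_surj]): turn every block of a given partition
    into an increasing cycle. This permutation has the right excedances, and
    exchanging the values of two crossing lower arcs keeps them while it
    decreases the sum of s * u s. A permutation with the same weak
    excedances that minimises this sum is therefore noncrossing. *)

Set Implicit Arguments.
Unset Strict Implicit.
Unset Printing Implicit Defensive.

(** * Noncrossing permutations *)

(** The conditions force u k < k and u s < s, so only lower arcs are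
    involved; equality u s = k is the case of two arcs that touch, one
    ending where the other starts. *)
Definition noncrossing n (u : {perm 'I_n}) : bool :=
  [forall k : 'I_n, forall s : 'I_n, ~~ [&& u k < u s, u s <= k & k < s]].

Lemma noncrossingP n (u : {perm 'I_n}) :
  reflect (forall k s : 'I_n, u k < u s -> u s <= k -> k < s -> False)
          (noncrossing u).
Proof.
apply: (iffP forallP) => [nc k s ks sk lt|nc k].
  by have /forallP/(_ s)/negP[] := nc k; apply/and3P.
by apply/forallP=> s; apply/negP=> /and3P[]; exact: nc.
Qed.

(** * Outcomes of Lehmer parking functions *)

Section Parking.

Variables (n : nat) (a : n.-tuple 'I_n).

Definition street_at (c : nat) : street n :=
  foldl (park a) [ffun=> None] (take c (enum 'I_n)).

Lemma street_at0 : street_at 0 = [ffun=> None].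
Proof. by rewrite /street_at take0. Qed.

Lemma street_atS (c : 'I_n) : street_at c.+1 = park a (street_at c) c.
Proof.
rewrite /street_at (take_nth c) ?size_enum_ord // nth_ord_enum.
by rewrite foldl_rcons.
Qed.

Lemma street_at_final : street_at n = final_street a.
Proof. by rewrite /street_at take_oversize ?size_enum_ord. Qed.

(** The street just before car c arrives, when the final street is p. *)
Definition street_of (p : {perm 'I_n}) (c : nat) : street n :=
  [ffun j => if p j < c then Some (p j) else None].

Lemma first_empty_Some (s : street n) (q j : 'I_n) :
  first_empty s q = Some j <->
  [/\ q <= j, s j = None & forall k : 'I_n, q <= k -> k < j -> s k != None].
Proof.
rewrite /first_empty; split.
  case: pickP => // i /and3P[qi /eqP si /forallP full] [<-]; split=> // k qk ki.
  by have /implyP := full k; rewrite qk ki; apply.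
case=> qj sj full; case: pickP => [i /and3P[qi /eqP si /forallP full']|].
  congr Some; apply: val_inj => /=; case: (ltngtP i j) => // [ij|ji].
    by have := full i qi ij; rewrite si.
  by have /implyP := full' j; rewrite qj ji sj => /(_ isT).
move=> /(_ j)/negbT/negP[]; rewrite qj sj eqxx /=.
by apply/forallP=> k; apply/implyP=> /andP[]; exact: full.
Qed.

Lemma park_cases (s : street n) (i j : 'I_n) :
  park a s i j = s j \/ s j = None /\ park a s i j = Some i.
Proof.
rewrite /park; case E: (first_empty _ _) => [k|]; last by left.
have [_ sk _] := (first_empty_Some _ _ _).1 E.
by rewrite ffunE; case: eqP => [->|_]; [right | left].
Qed.

Lemma street_at_lt (c : nat) (j x : 'I_n) :
  c <= n -> street_at c j = Some x -> x < c.
Proof.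
elim: c => [|c IH] cn; first by rewrite street_at0 ffunE.
rewrite (street_atS (Ordinal cn)).
case: (park_cases (street_at c) (Ordinal cn) j) => [->|[_ ->] [<-]] //.
by move=> /(IH (ltnW cn)) /ltnW.
Qed.

Lemma street_at_later (c d : nat) (j : 'I_n) : c <= d -> d <= n ->
  street_at d j = street_at c j \/
  street_at c j = None /\ exists2 x : 'I_n, c <= x & street_at d j = Some x.
Proof.
elim: d => [|d IH]; first by rewrite leqn0 => /eqP ->; left.
rewrite leq_eqVlt => /predU1P[-> _|cd dn]; first by left.
rewrite (street_atS (Ordinal dn)).
have {IH} := IH cd (ltnW dn).
case: (park_cases (street_at d) (Ordinal dn) j) => [->|[dN ->]] //.
rewrite dN => -[<-|[_ [x _]]] //; right; split=> //.
by exists (Ordinal dn).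
Qed.

(** Cars never move, so a spot that a final occupant p j < c fills in the end
    is already filled at time c, and any other spot is filled after time c. *)
Lemma street_at_of_final (p : {perm 'I_n}) (c : nat) : c <= n ->
  (forall j, final_street a j = Some (p j)) -> street_at c = street_of p c.
Proof.
move=> cn fin; apply/ffunP=> j; rewrite ffunE.
have := street_at_later j cn (leqnn n); rewrite street_at_final fin.
case=> [E|[-> [x cx [->]]]]; last by rewrite ltnNge cx.
by rewrite -E (street_at_lt cn (esym E)).
Qed.

(** When the final street is p, all intermediate streets are determined by p,
    so the parking rule becomes a condition on p and the preferences alone:
    each car finds only earlier cars between its preference and its spot. *)
Lemma final_streetP (p : {perm 'I_n}) :
  (forall j, final_street a j = Some (p j)) <->
  (forall s : 'I_n, [/\ tnth a (p s) <= s &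
     forall k : 'I_n, tnth a (p s) <= k -> k < s -> p k < p s]).
Proof.
split=> [fin s|run].
  have E : first_empty (street_at (p s)) (tnth a (p s)) = Some s.
    have := street_atS (p s); rewrite /park.
    rewrite (street_at_of_final (ltn_ord _) fin).
    rewrite (street_at_of_final (ltnW (ltn_ord _)) fin).
    case: (first_empty _ _) => [j|] /ffunP/(_ s); rewrite !ffunE ltnS leqnn ltnn.
      by case: eqP => [->|].
    by [].
  move: E; rewrite (street_at_of_final (ltnW (ltn_ord _)) fin).
  case/first_empty_Some => le _ full; split=> // k ak ks.
  by have := full k ak ks; rewrite ffunE; case: ifP.
have inv c : c <= n -> street_at c = street_of p c.
  elim: c => [|c IH] cn; first by rewrite street_at0; apply/ffunP=> j; rewrite !ffunE.
  rewrite (street_atS (Ordinal cn)) IH ?(ltnW cn) //=.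
  set i := Ordinal cn; pose s := (p^-1)%g i.
  have ps : p s = i by rewrite permKV.
  have [le full] := run s; rewrite ps in le full.
  rewrite /park (_ : first_empty _ _ = Some s); last first.
    apply/first_empty_Some; split=> //; first by rewrite ffunE ps ltnn.
    by move=> k ak ks; rewrite ffunE full.
  apply/ffunP=> j; rewrite !ffunE; case: eqP => [->|js].
    by rewrite ps ltnSn.
  have : p j != i by apply/eqP=> pj; apply: js; rewrite /s -pj permK.
  by rewrite -val_eqE /= ltnS (leq_eqVlt (p j)) => /negPf ->.
by move=> j; rewrite -street_at_final inv // ffunE ltn_ord.
Qed.

Lemma outcome_Some (p : {perm 'I_n}) :
  outcome a = Some p <-> forall j, final_street a j = Some (p j).
Proof.
rewrite /outcome; split.
  by case: pickP => // q /forallP qP [<-] j; apply/eqP.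
move=> fin; case: pickP => [q /forallP qP|/(_ p)/negbT/negP[]].
  congr Some; apply/permP=> j.
  by have := qP j; rewrite fin => /eqP[].
by apply/forallP=> j; rewrite fin.
Qed.

End Parking.

Definition rev_perm n : {perm 'I_n} := perm (@rev_ord_inj n).

Lemma rev_permE n (i : 'I_n) : rev_perm n i = rev_ord i.
Proof. exact: permE. Qed.

(** The car c in spot s may be given the preference min(s, n - 1 - c), the
    largest one that both reaches s and is allowed; this choice has the
    shortest window, so it works as soon as any choice does. *)
Lemma outcomes_LPF n :
  outcomes (LPF n) = [set p | noncrossing (p * rev_perm n)%g].
Proof.
apply/setP=> p; rewrite !inE; apply/exists_inP/noncrossingP.
  case=> a; rewrite inE => /forallP aL /eqP/outcome_Some/final_streetP run k s.
  rewrite !permM !rev_permE /= => ks sk lt.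
  have [_ /(_ k _ lt)] := run s; have := aL (p s); lia.
move=> nc.
have lt (c : 'I_n) : minn ((p^-1)%g c) (n - c.+1) < n by rewrite gtn_min ltn_ord.
pose a := [tuple Ordinal (lt c) | c < n]; exists a.
  by rewrite inE; apply/forallP=> c; rewrite tnth_mktuple /=; have := ltn_ord c; lia.
apply/eqP/outcome_Some/final_streetP => s; rewrite tnth_mktuple /= permK.
split=> [|k ak ks]; first lia.
apply: contraT; rewrite -leqNgt leq_eqVlt => /predU1P[/val_inj/perm_inj E|lt_p].
  by rewrite E ltnn in ks.
exfalso; apply: (nc k s) => //; rewrite !permM !rev_permE /=.
  by rewrite ltn_sub2l ?ltnS // (leq_trans _ (ltn_ord (p k))).
by move: ak; rewrite geq_min leqNgt ks.
Qed.

(** * The set partition of a permutation *)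

Section Arcs.

Variables (n : nat) (u : {perm 'I_n}).

Definition arc_back (s : 'I_n) : 'I_n :=
  if (u^-1)%g s < s then (u^-1)%g s else s.

(** Stepping back strictly decreases until it stops, so n steps always reach
    the first point of the excedance path through s. *)
Definition arc_root (s : 'I_n) : 'I_n := iter n arc_back s.

Definition arc_partition : {set {set 'I_n}} :=
  preim_partition arc_root [set: 'I_n].

Lemma arc_back_le (s : 'I_n) : arc_back s <= s.
Proof. by rewrite /arc_back; case: ifP => // /ltnW. Qed.

Lemma arc_root_fixed (s : 'I_n) : arc_back (arc_root s) = arc_root s.
Proof.
have desc m : iter m arc_back s + m <= s \/
    arc_back (iter m arc_back s) = iter m arc_back s.
  elim: m => [|m [IH|IH]] /=; first by left; rewrite addn0.
    set t := iter m _ _ in IH *.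
    rewrite {1 3}/arc_back; case: ifP => H.
      by left; rewrite addnS; apply: leq_trans IH; rewrite -addSn leq_add2r.
    by right; rewrite /arc_back !H.
  by right; rewrite !IH.
by case: (desc n) => // H; have := ltn_ord s; lia.
Qed.

Lemma arc_root_back (s : 'I_n) : arc_root (arc_back s) = arc_root s.
Proof. by rewrite {1}/arc_root -iterSr iterS -/(arc_root s) arc_root_fixed. Qed.

Lemma arc_root_le (s : 'I_n) : arc_root s <= s.
Proof.
rewrite /arc_root; move: (X in iter X) => m.
by elim: m => //= m; apply: leq_trans (arc_back_le _).
Qed.

Lemma arc_back_perm (s : 'I_n) : s < u s -> arc_back (u s) = s.
Proof. by move=> lt; rewrite /arc_back permK lt. Qed.

Lemma arc_root_perm (s : 'I_n) : s < u s -> arc_root (u s) = arc_root s.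
Proof. by move=> lt; rewrite -arc_root_back arc_back_perm. Qed.

(** Two points with the same root lie on one path, and the path increases, so
    the successor of the smaller one cannot pass the larger. The induction
    steps back from t to its predecessor p; if s lay strictly between p and
    t = u p, the induction hypothesis for p and s would give t <= s. *)
Lemma arc_root_next (s t : 'I_n) :
  arc_root s = arc_root t -> s < t -> s < u s <= t.
Proof.
have [m] := ubnP (val t); elim: m s t => // m IH s t /= tm st lt.
have := arc_root_back t; rewrite /arc_back; case: ifP => [pt|npt].
  set p := (u^-1)%g t in pt *; move=> rp.
  have up : u p = t by rewrite permKV.
  case: (ltngtP s p) => [sp|ps|/val_inj ->].
  - have /andP[-> /= le] := IH s p (leq_trans pt tm) (etrans st (esym rp)) sp.
    exact: leq_trans le (ltnW pt).
  - have /andP[_] := IH p s (leq_trans lt tm) (etrans rp (esym st)) ps.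
    by rewrite up leqNgt lt.
  - by rewrite up pt leqnn.
have fix_t m' : iter m' arc_back t = t.
  by elim: m' => //= m' ->; rewrite /arc_back npt.
have := arc_root_le s; rewrite st /arc_root fix_t; lia.
Qed.

End Arcs.

Lemma same_pblock_arc n (u : {perm 'I_n}) (s t : 'I_n) :
  (t \in pblock (arc_partition u) s) = (arc_root u s == arc_root u t).
Proof.
rewrite /arc_partition /preim_partition pblock_equivalence_partition ?inE //.
by split=> // /eqP ->.
Qed.

(** * A noncrossing permutation is determined by its partition *)

Section Injective.

Variables (n : nat).
Implicit Types u v : {perm 'I_n}.

(** If i were not fixed, the lower arc from i and the lower arc to i would
    touch at i. *)
Lemma noncrossing_fixed u (i : 'I_n) : noncrossing u ->
  u i <= i -> (forall j : 'I_n, u j = i -> i <= j) -> u i = i.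
Proof.
move=> /noncrossingP nc le src; apply: val_inj => /=.
have uk : u ((u^-1)%g i) = i by rewrite permKV.
have := src _ uk; rewrite leq_eqVlt => /predU1P[/val_inj e|lt].
  by rewrite {1}e uk.
apply/eqP; rewrite eqn_leq le /= leqNgt; apply/negP=> ui.
by apply: (nc i ((u^-1)%g i)); rewrite ?uk.
Qed.

Lemma eq_excedances_le u v :
  arc_partition u = arc_partition v ->
  forall s : 'I_n, s < u s -> s < v s <= u s.
Proof.
move=> E s lt; apply: arc_root_next => //; apply/eqP.
by rewrite -same_pblock_arc -E same_pblock_arc arc_root_perm.
Qed.

Lemma eq_excedances u v :
  arc_partition u = arc_partition v ->
  forall s : 'I_n, s < u s -> u s = v s.
Proof.
move=> E s lt; have /andP[lt' le] := eq_excedances_le E lt.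
have /andP[_ le'] := eq_excedances_le (esym E) lt'.
by apply: val_inj; apply/eqP; rewrite eqn_leq le le'.
Qed.

(** A fixed point s of u lies on no excedance of u, hence on none of v, so it
    is fixed by v too. *)
Lemma noncrossing_weak_excedance u v (s : 'I_n) :
  noncrossing v -> arc_partition u = arc_partition v -> s <= u s -> u s = v s.
Proof.
move=> nv E; rewrite leq_eqVlt => /predU1P[/val_inj us|]; last exact: eq_excedances.
rewrite -us; symmetry; apply: noncrossing_fixed => //.
  rewrite leqNgt; apply/negP=> lt.
  by have := eq_excedances (esym E) lt; rewrite -us => e; rewrite e ltnn in lt.
move=> j vj; rewrite leqNgt; apply/negP=> lt.
have := eq_excedances (esym E) (s := j); rewrite vj lt => /(_ isT).
by rewrite {1}us => /perm_inj e; rewrite e ltnn in lt.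
Qed.

(** Below the weak excedances, take the first position s where u and v could
    differ. The value v s is not taken by u before s; if it exceeded u s, then
    u would take it after s, and that arc would cross the one at s. *)
Lemma arc_partition_inj :
  {in [pred u | noncrossing u] &, injective (@arc_partition n)}.
Proof.
move=> u v; rewrite !inE => nu nv E; apply/permP=> s.
have [m] := ubnP (val s); elim: m s => // m IH s /= sm.
have [le|us] := leqP s (u s); first exact: noncrossing_weak_excedance.
have [le|vs] := leqP s (v s).
  by symmetry; apply: noncrossing_weak_excedance.
have aux (u' v' : {perm 'I_n}) : noncrossing u' ->
    (forall j : 'I_n, j < s -> u' j = v' j) -> v' s < s -> v' s <= u' s.
  move=> /noncrossingP nc IH' vs'; rewrite leqNgt; apply/negP=> lt.
  pose t := (u'^-1)%g (v' s); have ut : u' t = v' s by rewrite permKV.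
  case: (ltngtP s t) => [st|ts|/val_inj st].
  - by apply: (nc s t) => //; rewrite ut // ltnW.
  - by have := IH' t ts; rewrite ut => /perm_inj e; rewrite e ltnn in ts.
  - by rewrite -ut -st ltnn in lt.
have IH' (j : 'I_n) : j < s -> u j = v j by move=> js; apply: IH; exact: leq_trans js sm.
apply: val_inj; apply/eqP; rewrite eqn_leq !aux //.
by move=> j js; rewrite IH'.
Qed.

End Injective.

(** * A set partition as a permutation with increasing cycles *)

Section Cyclic.

Variables (n : nat) (P : {set {set 'I_n}}).
Hypothesis partP : partition P [set: 'I_n].

Let mem_own (s : 'I_n) : s \in pblock P s.
Proof. by rewrite mem_pblock (cover_partition partP) inE. Qed.

Let own_eq (s t : 'I_n) : t \in pblock P s -> pblock P t = pblock P s.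
Proof. by apply: same_pblock; case/and3P: partP. Qed.

(** The default s of the second minimum belongs to its own block, so that
    this minimum is the least element of the block. *)
Definition block_next (s : 'I_n) : 'I_n :=
  if [pick t in pblock P s | s < t] is Some t0
  then [arg min_(t < t0 | (t \in pblock P s) && (s < t)) t]
  else [arg min_(t < s in pblock P s) t].

Variant block_next_spec (s : 'I_n) : 'I_n -> Prop :=
  | BlockNext t of t \in pblock P s & s < t &
      (forall r : 'I_n, r \in pblock P s -> s < r -> t <= r) :
      block_next_spec s t
  | BlockWrap t of t \in pblock P s &
      (forall r : 'I_n, r \in pblock P s -> t <= r <= s) :
      block_next_spec s t.

Lemma block_nextP (s : 'I_n) : block_next_spec s (block_next s).
Proof.
rewrite /block_next; case: pickP => [t0 t0P|last_s].
  case: arg_minnP => //= t /andP[tB st] tmin; apply: BlockNext => // r rB sr.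
  by apply: tmin; rewrite rB.
case: arg_minnP => //= t tB tmin; apply: BlockWrap => // r rB.
by rewrite tmin //= leqNgt; have := last_s r; rewrite rB /= => ->.
Qed.

Lemma block_next_mem (s : 'I_n) : block_next s \in pblock P s.
Proof. by case: block_nextP. Qed.

Lemma block_next_inj : injective block_next.
Proof.
move=> s s' E.
have B : pblock P s = pblock P s'.
  by rewrite -(own_eq (block_next_mem s)) E (own_eq (block_next_mem s')).
have sB := mem_own s; have sB' := mem_own s'; rewrite B in sB; rewrite -B in sB'.
move: E; case: block_nextP => [t tB lt tm|t tB tm];
  case: block_nextP => [t' tB' lt' tm'|t' tB' tm'] E; subst t';
  apply: val_inj => /=.
- by have := tm s' sB'; have := tm' s sB; lia.
- by have := tm' s sB; lia.
- by have := tm s' sB'; lia.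
- by have := tm s' sB'; have := tm' s sB; lia.
Qed.

Definition block_cycle : {perm 'I_n} := perm block_next_inj.

Lemma block_cycle_mem (s : 'I_n) : block_cycle s \in pblock P s.
Proof. by rewrite permE block_next_mem. Qed.

(** The largest element p of the block below r is sent to the next element
    above p, which is r. *)
Lemma block_cycle_pred (r t : 'I_n) : t \in pblock P r -> t < r ->
  exists2 p : 'I_n, p < r & block_cycle p = r.
Proof.
move=> tB tr.
have t0 : (t \in pblock P r) && (t < r) by rewrite tB.
case: (@arg_maxnP _ t (fun p => (p \in pblock P r) && (p < r)) val t0).
move=> p /andP[pB pr] pmax; exists p => //; rewrite permE.
have B := own_eq pB; have rB := mem_own r; rewrite -B in rB pmax.
case: block_nextP => [q qB pq qm|q qB qm]; last by have := qm r rB; lia.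
apply: val_inj => /=; have := qm r rB pr; have := pmax q; rewrite qB /=; lia.
Qed.

(** Agreement on weak excedances only, with the remaining positions kept
    strictly deficient: the freedom left is how the lower arcs are matched. *)
Definition same_excedances (u : {perm 'I_n}) : bool :=
  [forall s : 'I_n, if s <= block_cycle s then u s == block_cycle s else u s < s].

Lemma same_excedancesP (u : {perm 'I_n}) : same_excedances u ->
  forall s : 'I_n, (s <= block_cycle s -> u s = block_cycle s) /\
                   (block_cycle s < s -> u s < s).
Proof.
by move=> /forallP su s; have := su s; case: (leqP s (block_cycle s)) => [_ /eqP|].
Qed.

Lemma same_excedances_exc (u : {perm 'I_n}) (s : 'I_n) : same_excedances u ->
  s <= u s -> u s = block_cycle s.
Proof.
move=> /same_excedancesP /(_ s)[ge lt] le; apply: ge.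
by rewrite leqNgt; apply/negP=> /lt; rewrite ltnNge le.
Qed.

(** The excedances of u stay inside the blocks, so roots do too; and the root
    of s is the least element of its block, because every other element is
    the target of an excedance and one can step back from it. *)
Lemma same_excedances_partition (u : {perm 'I_n}) :
  same_excedances u -> arc_partition u = P.
Proof.
move=> su.
have backB s : arc_back u s \in pblock P s.
  rewrite /arc_back; case: ifP => // lt; set p := (u^-1)%g s in lt *.
  have up : u p = s by rewrite permKV.
  have := same_excedances_exc su (s := p); rewrite up (ltnW lt) => /(_ isT) E.
  have := block_cycle_mem p; rewrite -E => /own_eq ->; exact: mem_own.
have rootB s : arc_root u s \in pblock P s.
  rewrite /arc_root; move: (X in iter X) => m.
  by elim: m => //= m /own_eq <-.
have root_min s t : t \in pblock P s -> arc_root u s <= t.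
  move=> tB; rewrite leqNgt; apply/negP=> lt.
  have := tB; rewrite -(own_eq (rootB s)) => /block_cycle_pred/(_ lt)[p pr E].
  have [+ _] := same_excedancesP su p; rewrite E (ltnW pr) => /(_ isT) up.
  have := arc_root_fixed u s; rewrite -up arc_back_perm ?up // => e.
  by rewrite {1}e ltnn in pr.
rewrite -(equivalence_partition_pblock partP); apply: eq_imset => s.
apply/setP=> t; rewrite !inE /=; apply/eqP/idP => [E|tB].
  by rewrite -(own_eq (rootB s)) E (own_eq (rootB t)).
have B := own_eq tB.
by apply: val_inj; apply/eqP; rewrite eqn_leq !root_min // ?B // -B.
Qed.

End Cyclic.

(** * Uncrossing the lower arcs *)

Section Uncross.

Variables (n : nat) (P : {set {set 'I_n}}).
Hypothesis partP : partition P [set: 'I_n].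

Lemma same_excedances_cycle : same_excedances partP (block_cycle partP).
Proof. by apply/forallP=> s; case: (leqP s (block_cycle partP s)). Qed.

(** After the exchange both arcs must still point strictly down. This could
    only fail at k, when u s = k; but k is deficient, hence not the least
    element of its block, hence already the target of an excedance. *)
Lemma same_excedances_swap (u : {perm 'I_n}) (k s : 'I_n) :
  same_excedances partP u -> u k < u s -> u s <= k -> k < s ->
  same_excedances partP (tperm k s * u)%g.
Proof.
move=> su ks sk lt.
have drop (r : 'I_n) : u r < r -> block_cycle partP r < r.
  move=> ur; rewrite ltnNge; apply/negP=> le.
  by have [/(_ le) e _] := same_excedancesP su r; rewrite ltnNge e le in ur.
have ck := drop k (leq_trans ks sk); have cs := drop s (leq_ltn_trans sk lt).
have sk' : u s < k.
  rewrite ltn_neqAle sk andbT; apply/eqP=> /val_inj usk.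
  have [p pk cp] := block_cycle_pred partP (block_cycle_mem partP k) ck.
  have [/(_ _)up _] := same_excedancesP su p.
  have ps : p = s by apply: (@perm_inj _ u); rewrite usk up cp // ltnW.
  by rewrite ps ltnNge (ltnW lt) in pk.
apply/forallP=> r; rewrite permM; case: tpermP => [->|->|_ _].
- by rewrite leqNgt ck.
- by rewrite leqNgt cs /= (ltn_trans ks (leq_ltn_trans sk lt)).
- exact: (forallP su).
Qed.

Lemma arc_partition_surj :
  exists2 u : {perm 'I_n}, noncrossing u & arc_partition u = P.
Proof.
pose weight (u : {perm 'I_n}) := \sum_(i < n) i * u i.
case: (arg_minnP weight same_excedances_cycle) => u su umin.
exists u; last exact: same_excedances_partition su.
apply/noncrossingP=> k s ks sk lt.
have := umin _ (same_excedances_swap su ks sk lt); rewrite leqNgt => /negP[].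
have ksN : s != k by apply/eqP=> e; rewrite e ltnn in lt.
(* Exchanging lowers the sum by (s - k) * (u s - u k). *)
rewrite /weight (bigD1 k) // (bigD1 s) //= [ltnRHS](bigD1 k) // [in ltnRHS](bigD1 s) //=.
rewrite !permM tpermL tpermR !addnA.
rewrite (eq_bigr (fun i : 'I_n => i * u i)); last first.
  by move=> i /andP[ik is_]; rewrite permM tpermD // eq_sym.
rewrite ltn_add2r; nia.
Qed.

End Uncross.

Theorem corollary3p1 (n : nat) : #|outcomes (LPF n)| = Bell n.
Proof.
have -> : #|outcomes (LPF n)| = #|[set u : {perm 'I_n} | noncrossing u]|.
  rewrite outcomes_LPF -(card_preimset _ (@mulIg _ (rev_perm n))).
  by apply: eq_card => p; rewrite !inE.
rewrite -(card_in_imset (f := @arc_partition n)); last first.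
  by move=> u v; rewrite !inE => nu nv; apply: arc_partition_inj.
apply: eq_card => P; rewrite [in RHS]inE; apply/imsetP/idP => [[u _ ->]|partP].
  exact: preim_partitionP.
have [u nu <-] := arc_partition_surj partP.
by exists u; rewrite // inE.
Qed.
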